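(* If $\kappa$ is a weakly compact cardinal, then $\mathrm{PH}_n(\kappa)$ holds for every $n\in\omega$.
   Context: For a directed quasi-order $(P,\le)$ and $m\ge1$: $P^{\le m}=\bigcup_{i=1}^mP^i$; $\mathbf{x}\trianglelefteq\mathbf{y}$ means $\mathbf{x}$ is obtained from $\mathbf{y}$ by deleting coordinates; $P\langle\langle m\rangle\rangle$ is the set of $\sigma=(\sigma(1),\dots,\sigma(m))$ with $\sigma(i)\in P^i$ and $\sigma(1)\trianglelefteq\cdots\trianglelefteq\sigma(m)$ ($P^1=P$). $F:P^{\le m}\to P$ is $m$-cofinal if $x\le F(x)$ for $x\in P$ and $F(\mathbf{x})\le F(\mathbf{y})$ whenever $\mathbf{x}\trianglelefteq\mathbf{y}$; $F^*(\sigma)=(F(\sigma(1)),\dots,F(\sigma(m)))$. $\mathrm{PH}_n(P,\lambda)$: for every $c:P^{n+1}\to\lambda$ there is an $(n+1)$-cofinal $F:P^{\le n+1}\to P$ with $c\circ F^*$ constant. $\mathrm{PH}_n(\kappa)=\mathrm{PH}_n(\kappa,\omega)$, $\kappa$ ordered as an ordinal. *)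

(* Defs.v *)
From mathcomp Require Import all_boot all_order.
From mathcomp Require Import all_classical wochoice.

Set Implicit Arguments.
Unset Strict Implicit.
Unset Printing Implicit Defensive.

Local Open Scope order_scope.
Local Open Scope card_scope.

(* The following definitions make sense for any quasi-order P;
   directedness is not built in, since it holds automatically for the linear
   orders (ordinals) to which PH is applied below. *)

Definition nonempty_upto (d : Order.disp_t) (P : preorderType d) (m : nat) :=
  {s : seq P | (0 < size s <= m)%N}.

Definition cofinal_fun (d : Order.disp_t) (P : preorderType d) (m : nat)
    (F : nonempty_upto P m -> P) : Prop :=
  (forall (s : nonempty_upto P m) (x : P), val s = [:: x] -> x <= F s) /\
  (forall s t : nonempty_upto P m, subseq (val s) (val t) -> F s <= F t).

(* The set P<<m>>; the index i : 'I_m stands for the position i + 1. *)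
Definition chain_seq (d : Order.disp_t) (P : preorderType d) (m : nat)
    (sigma : m.-tuple (nonempty_upto P m)) : Prop :=
  (forall i : 'I_m, size (val (tnth sigma i)) = i.+1) /\
  (forall i j : 'I_m, (i <= j)%N ->
     subseq (val (tnth sigma i)) (val (tnth sigma j))).

Definition Fstar (d : Order.disp_t) (P : preorderType d) (m : nat)
    (F : nonempty_upto P m -> P) (sigma : m.-tuple (nonempty_upto P m)) :
    m.-tuple P :=
  [tuple F (tnth sigma i) | i < m].

Definition PH_col (n : nat) (d : Order.disp_t) (P : preorderType d)
    (L : Type) : Prop :=
  forall c : n.+1.-tuple P -> L,
  exists2 F : nonempty_upto P n.+1 -> P, cofinal_fun F &
    exists l : L, forall sigma : n.+1.-tuple (nonempty_upto P n.+1),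
      chain_seq sigma -> c (Fstar F sigma) = l.

Definition PH (n : nat) (d : Order.disp_t) (P : preorderType d) : Prop :=
  PH_col n P nat.

(* A cardinal kappa is represented by a type K with a linear order
   isomorphic to that of the initial ordinal kappa: a well-order in which no
   proper initial segment has as many elements as K. *)
Definition cardinal_order (d : Order.disp_t) (K : orderType d) : Prop :=
  well_order (<=%O : rel K) /\
  forall x : K, ~ ([set: K]%classic #<= [set y : K | y < x]%classic).

(* kappa -> (kappa)^n_L, an n-element subset of K being given by its
   increasing enumeration. *)
Definition arrow (d : Order.disp_t) (K : orderType d) (n : nat) (L : Type) :
    Prop :=
  forall f : n.-tuple K -> L,
  exists2 H : set K, H #= [set: K]%classic &
    exists l : L, forall t : n.-tuple K, sorted <%O t ->
      (forall x, x \in t -> H x) -> f t = l.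

Definition weakly_compact (d : Order.disp_t) (K : orderType d) : Prop :=
  [/\ cardinal_order K, ~ countable [set: K]%classic & arrow K 2 bool].

(* Main.v *)
(* The relation kappa -> (kappa)^2_2 makes kappa regular and, applied to the
   lexicographic comparison of the sequences (f(t, a))_t, gives an unbounded set
   along which each f(t, _) is eventually constant; lexicographic monotonicity
   together with regularity suffices for this, so inaccessibility and trees are
   not needed. Thinning makes f end-homogeneous, and induction on the arity gives
   kappa -> (kappa)^{n+1}_omega. For H homogeneous for c, let nu x be the least
   element of H above x and F(s) = nu^{|s|}(max s): then F is cofinal, and F^*
   maps chains to increasing tuples of H. *)

Require Import Defs.
From mathcomp Require Import all_boot all_order.
From mathcomp Require Import all_classical wochoice.

Set Implicit Arguments.
Unset Strict Implicit.
Unset Printing Implicit Defensive.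

Import Order.TTheory.
Local Open Scope classical_set_scope.
Local Open Scope order_scope.
Local Open Scope card_scope.

(** * Least elements and maxima of finite sequences *)

Lemma well_order_least (T : Type) (R : rel T) (P : T -> Prop) :
  well_order R -> (exists x, P x) -> exists2 x, P x & forall y, P y -> R x y.
Proof.
move=> Rwo [x Px]; have [|z [[Pz zmin] _]] := Rwo [pred y | `[< P y >]].
  by exists x; apply/asboolP.
by exists z => [|y Py]; [exact/asboolP | apply: zmin; apply/asboolP].
Qed.

(** Stands in for full cardinality: full sets are unbounded, and unboundedness is what successive
    thinnings preserve. *)
Definition unbounded (d : Order.disp_t) (K : orderType d) (H : set K) : Prop :=
  forall x, exists2 y, H y & x < y.

Lemma le_foldr_max (d : Order.disp_t) (K : orderType d) (x0 : K) (s : seq K) (x : K) :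
  x \in s -> x <= foldr Order.max x0 s.
Proof.
elim: s => //= y s IHs; rewrite inE le_max => /orP[/eqP <-|/IHs ->].
  by rewrite lexx.
by rewrite orbT.
Qed.

Lemma foldr_max_subseq (d : Order.disp_t) (K : orderType d) (x0 : K) (s t : seq K) :
  subseq s t -> foldr Order.max x0 s <= foldr Order.max x0 t.
Proof.
have x0le u : x0 <= foldr Order.max x0 u.
  by elim: u => //= y u IHu; rewrite le_max IHu orbT.
move=> /mem_subseq; elim: s => //= y s IHs yst; rewrite ge_max IHs; last first.
  by move=> z zs; apply: yst; rewrite inE zs orbT.
by rewrite le_foldr_max // yst // mem_head.
Qed.

Lemma path_lt_le_last (d : Order.disp_t) (K : orderType d) (x y : K) (s : seq K) :
  path <%O x s -> y \in x :: s -> y <= last x s.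
Proof.
elim: s x y => [|z s IHs] x y /=; first by rewrite inE => _ /eqP ->.
move=> /andP[xz zs]; rewrite inE => /orP[/eqP ->|]; last exact: IHs.
by apply: le_trans (ltW xz) _; apply: IHs => //; exact: mem_head.
Qed.

(** * Unboundedness and regularity from the partition relation for pairs *)

Section WeaklyCompact.
Variables (d : Order.disp_t) (K : orderType d).
Hypothesis hK : weakly_compact K.

Let least (P : K -> Prop) :
  (exists x, P x) -> exists2 x, P x & forall y, P y -> x <= y.
Proof. by have [[Kwo _] _ _] := hK; exact: well_order_least. Qed.

Lemma full_card_uncountable (H : set K) : H #= [set: K] -> ~ countable H.
Proof. by move=> /eq_countable ->; have [] := hK. Qed.

Lemma weakly_compact_inhabited : inhabited K.
Proof.
apply: contrapT => K0; apply: (full_card_uncountable (card_eqxx [set: K])).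
suff -> : [set: K] = set0 by exact: countable0.
by apply/seteqP; split=> // x; case: K0.
Qed.

Lemma full_card_not_below (H : set K) (x : K) :
  H #= [set: K] -> ~ H `<=` [set y | y < x].
Proof.
move=> HK /subset_card_le; rewrite (card_le_eql HK).
by have [[_ +] _ _] := hK; apply.
Qed.

Lemma arrow_pairs (c : K -> K -> bool) :
  exists2 H : set K, H #= [set: K] &
    exists l, forall x y, H x -> H y -> x < y -> c x y = l.
Proof.
have [_ _ ar] := hK.
have [H HK [l Hl]] := ar (fun t => c (tnth t ord0) (tnth t ord_max)).
exists H => //; exists l => x y Hx Hy xy.
rewrite -(Hl [tuple x; y]) //= ?xy // => z.
by rewrite !inE => /orP[] /eqP ->.
Qed.

(** Were [m] the maximum, colour a pair by whether its upper element is [m]. A homogeneous set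
    missing [m] lies below [m], and one containing [m] has at most two elements; neither is full. *)
Lemma weakly_compact_no_max (m : K) : exists x, m < x.
Proof.
apply: contrapT => /forallNP mmax.
have {}mmax x : x <= m by rewrite leNgt; apply/negP/mmax.
have [H HK [l Hl]] := arrow_pairs (fun _ y => y == m).
have [Hm|nHm] := pselect (H m); last first.
  apply: (full_card_not_below HK (x := m)) => y Hy /=.
  by rewrite lt_neqAle mmax andbT; apply/eqP => ym; rewrite ym in Hy.
apply: (full_card_uncountable HK).
have [[a [Ha am]]|noa] := pselect (exists a, H a /\ a < m).
  have lT : l = true by rewrite -(Hl _ _ Ha Hm am) eqxx.
  apply: finite_set_countable; apply: (sub_finite_set _ (finite_set2 a m)).
  move=> y Hy /=; case: (ltgtP y a) => [ya|ay|->]; [| |by left].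
    by have /= := Hl _ _ Hy Ha ya; rewrite lT lt_eqF.
  by right; have /= := Hl _ _ Ha Hy ay; rewrite lT => /eqP.
apply: finite_set_countable; apply: (sub_finite_set _ (finite_set1 m)).
move=> y Hy /=; apply/eqP; rewrite eq_le mmax /= leNgt; apply/negP => ym.
by apply: noa; exists y.
Qed.

Lemma full_card_unbounded (H : set K) : H #= [set: K] -> unbounded H.
Proof.
move=> HK x; have [z xz] := weakly_compact_no_max x.
apply: contrapT => nH; apply: (full_card_not_below HK (x := z)) => y Hy /=.
apply: le_lt_trans xz; rewrite leNgt; apply/negP => xy.
by apply: nH; exists y.
Qed.

(** If [g] is cofinal on [A], pick [p x] in [A] with [x <= g (p x)] and colour pairs by [p x = p y].
    On a homogeneous set [p] is either constant from some [a] on, so that [g (p a)] bounds an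
    unbounded set, or injective, so that [K] embeds in [A]. *)
Lemma weakly_compact_regular (I : Type) (A : set I) (g : I -> K) :
  ~ ([set: K] #<= A) -> exists b, forall i, A i -> g i < b.
Proof.
move=> KA; apply: contrapT => /forallNP gunb.
have {gunb} /choice[p pP] x : exists i, A i /\ x <= g i.
  have /existsNP[i /not_implyP[Ai xi]] := gunb x.
  by exists i; split=> //; rewrite leNgt; apply/negP.
have [H HK [l Hl]] := arrow_pairs (fun x y => `[< p x = p y >]).
have Hunb := full_card_unbounded HK; case: l Hl => Hl.
  have [x0] := weakly_compact_inhabited.
  have [a Ha _] := Hunb x0.
  have [b Hb] := Hunb (g (p a)); rewrite ltNge => /negP; apply.
  have [c Hc] := Hunb (Order.max a b); rewrite gt_max => /andP[ac bc].
  have /asboolP -> := Hl _ _ Ha Hc ac; have /asboolP <- := Hl _ _ Hb Hc bc.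
  by have [] := pP b.
apply: KA; rewrite -(card_le_eql HK).
have pinj : {in H &, injective p}.
  move=> x y /set_mem Hx /set_mem Hy pxy; case: (ltgtP x y) => // xy.
    by have /asboolP := Hl _ _ Hx Hy xy.
  by have /asboolP := Hl _ _ Hy Hx xy; case.
rewrite -(card_le_eql (inj_card_eq pinj)); apply: subset_card_le.
by move=> _ [x Hx <-]; have [] := pP x.
Qed.

(** * Bounds for small families *)

Lemma bounded_nat (g : nat -> K) : exists b, forall i, g i < b.
Proof.
have [_ Kunc _] := hK.
have [b bP] := weakly_compact_regular (A := [set: nat]) g Kunc.
by exists b => i; exact: bP.
Qed.

Lemma bounded_segment (m : K) (g : K -> K) :
  exists b, forall x, x <= m -> g x < b.
Proof.
have [m' mm'] := weakly_compact_no_max m; have [[_ Kseg] _ _] := hK.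
have [b bP] := weakly_compact_regular g (Kseg m').
by exists b => x xm; apply: bP; exact: le_lt_trans mm'.
Qed.

(** Induction on the length: for each head take a bound over the tails, then bound these bounds over
    all heads up to [m]. *)
Lemma bounded_tuples (n : nat) (m : K) (g : n.-tuple K -> K) :
  exists b, forall t : n.-tuple K, (forall x, x \in t -> x <= m) -> g t < b.
Proof.
elim: n g => [|n IHn] g.
  have [b gb] := weakly_compact_no_max (g [tuple]).
  by exists b => t _; rewrite tuple0.
have /choice[h hP] x := IHn (fun t => g [tuple of x :: t]).
have [b bP] := bounded_segment m h.
exists b => t; case/tupleP: t => x t tm.
have xm : x <= m by apply: tm; rewrite inE eqxx.
apply: lt_trans (bP _ xm); apply: hP => y yt.
by apply: tm; rewrite inE yt orbT.
Qed.

(** * Thinning unbounded sets: homogeneity and stabilisation *)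

Lemma unbounded_next (A : set K) : unbounded A ->
  exists2 nu : K -> K, forall x, A (nu x) /\ x < nu x &
    {homo nu : x y / x <= y}.
Proof.
move=> Aunb.
have /choice[nu nuP] x : exists y, [/\ A y, x < y &
    forall z, A z -> x < z -> y <= z].
  have [|y [Ay xy] ymin] := @least (fun y => A y /\ x < y).
    by have [y Ay xy] := Aunb x; exists y.
  by exists y; split=> // z Az xz; exact: ymin.
exists nu => [x|x y xy]; first by have [] := nuP x.
have [_ _ numin] := nuP x; have [Ay yy _] := nuP y.
by apply: numin => //; exact: le_lt_trans yy.
Qed.

Lemma unbounded_pairs (A : set K) (c : K -> K -> bool) : unbounded A ->
  exists H : set K, [/\ unbounded H, H `<=` A &
    exists l, forall x y, H x -> H y -> x < y -> c x y = l].
Proof.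
move=> /unbounded_next[nu nuP numono].
(* As [nu] is monotone, an increasing pair in its image comes from an
   increasing pair. *)
have [H HK [l Hl]] := arrow_pairs (fun x y => c (nu x) (nu y)).
exists (nu @` H); split.
- move=> x; have [y Hy xy] := full_card_unbounded HK x.
  by exists (nu y); [exists y | have [_ yy] := nuP y; exact: lt_trans yy].
- by move=> _ [x _ <-]; have [] := nuP x.
- exists l => _ _ [x Hx <-] [y Hy <-] xy; apply: Hl => //.
  by rewrite ltNge; apply: contraTN xy => /numono; rewrite -leNgt.
Qed.

(** Let [h k] be a point where [x] has reached [k], if there is one. These countably many points
    have a common bound, past which [x] can no longer grow. *)
Lemma nondecreasing_eventually_constant (H : set K) (x : K -> nat) (g : K) :
  unbounded H ->
  (forall a b, H a -> H b -> g < a -> a < b -> (x a <= x b)%N) ->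
  exists g' v, forall a, H a -> g' < a -> x a = v.
Proof.
move=> Hunb xmono.
have /choice[h hP] (k : nat) : exists b, (exists a, [/\ H a, g < a & (k <= x a)%N]) ->
    [/\ H b, g < b & (k <= x b)%N].
  have [[a aP]|na] := pselect (exists a, [/\ H a, g < a & (k <= x a)%N]).
    by exists a.
  by exists g.
have [b bP] := bounded_nat h.
have [a Ha] := Hunb (Order.max g b); rewrite gt_max => /andP[ga ba].
exists a, (x a) => a' Ha' aa'; apply/eqP; rewrite eqn_leq.
rewrite [X in _ && X]xmono // andbT.
have [|Hh gh le_h] := hP (x a'); first by exists a'; split=> //; exact: lt_trans aa'.
by apply: leq_trans le_h _; apply: xmono => //; exact: lt_trans (bP _) ba.
Qed.

(** Past a point where the least value is attained, [x] cannot drop. *)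
Lemma nonincreasing_eventually_constant (H : set K) (x : K -> nat) (g : K) :
  unbounded H ->
  (forall a b, H a -> H b -> g < a -> a < b -> (x b <= x a)%N) ->
  exists g' v, forall a, H a -> g' < a -> x a = v.
Proof.
move=> Hunb xmono.
have /ex_minnP[v /asboolP[a [Ha ga xa]] vmin] :
    exists v, `[< exists a, [/\ H a, g < a & x a = v] >].
  by have [a Ha ga] := Hunb g; exists (x a); apply/asboolP; exists a.
exists a, v => b Hb ab; apply/eqP; rewrite eqn_leq -{1}xa xmono //=.
by apply: vmin; apply/asboolP; exists b; split=> //; exact: lt_trans ab.
Qed.

(* Colour pairs by the lexicographic order of the sequences [x a]: along a
   homogeneous set the sequences are lexicographically monotone, so once all
   earlier coordinates have stabilised the next one is monotone. *)
Lemma eventually_constant_subfamily (I : Type) (R : rel I) (A : set K)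
    (x : K -> I -> nat) :
  well_order R -> total R -> antisymmetric R ->
  (forall (i : I) (g : I -> K),
     exists b, forall j, R j i -> g j < b) ->
  unbounded A ->
  exists H : set K, [/\ unbounded H, H `<=` A &
    forall i, exists g v, forall a, H a -> g < a -> x a i = v].
Proof.
move=> Rwo Rtot Ranti Rbd Aunb.
pose lexle a b := forall i,
  (forall j, R j i -> ~ R i j -> x a j = x b j) -> (x a i <= x b i)%N.
have [H [Hunb HA [l Hl]]] := unbounded_pairs (fun a b => `[< lexle a b >]) Aunb.
exists H; split=> // i0; apply: contrapT => nconst0.
have [|i nconst imin] := well_order_least
    (P := fun i => ~ exists g v, forall a, H a -> g < a -> x a i = v) Rwo.
  by exists i0.
have /choice[g gP] j : exists g, R j i -> ~ R i j ->
    exists v, forall a, H a -> g < a -> x a j = v.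
  have [[g [v gv]]|nj] := pselect (exists g v, forall a, H a -> g < a -> x a j = v).
    by exists g => _ _; exists v.
  have [x0] := weakly_compact_inhabited.
  by exists x0 => _ []; exact: imin.
have [b bP] := Rbd i g.
have agree a a' : H a -> H a' -> b < a -> a < a' ->
    forall j, R j i -> ~ R i j -> x a j = x a' j.
  move=> Ha Ha' ba aa' j ji nij; have [v vP] := gP j ji nij.
  have ja := lt_trans (bP j ji) ba.
  by rewrite !vP //; exact: lt_trans aa'.
apply: nconst; case: l Hl => Hl.
  apply: (nondecreasing_eventually_constant (g := b) Hunb) => a a' Ha Ha' ba aa'.
  by have /asboolP := Hl _ _ Ha Ha' aa'; apply; exact: agree.
apply: (nonincreasing_eventually_constant (g := b) Hunb) => a a' Ha Ha' ba aa'.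
have /asboolP := Hl _ _ Ha Ha' aa'.
(* The comparison fails at some [j]. It is not strictly before [i], where coordinates agree; if it
   is strictly after [i], [jagree] gives equality at [i]; otherwise [j = i]. *)
move=> /existsNP[j /not_implyP[jagree /negP]]; rewrite -ltnNge => jlt.
have [ij|nij] := pselect (R i j); last first.
  by move: jlt; rewrite (agree a a') ?ltnn //; have /orP[] := Rtot i j.
have [ji|nji] := pselect (R j i); last by rewrite jagree.
by rewrite (Ranti i j) ?ij // ltnW.
Qed.

(** * From pairs to tuples: homogeneous sets in every finite arity *)

Lemma tuple_well_order (n : nat) :
  exists R : rel (n.-tuple K), [/\ well_order R, total R, antisymmetric R &
    forall t (g : n.-tuple K -> K), exists b, forall s, R s t -> g s < b].
Proof.
have [x0] := weakly_compact_inhabited.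
pose mx (t : n.-tuple K) := foldr Order.max x0 t.
(* Tuples are ordered by their maximum first, so that the predecessors of [t]
   have all their entries below [mx t]; ties are broken arbitrarily. *)
have [W Wwo] := well_ordering_principle (n.-tuple K).
have Wchain : wo_chain W predT by exact: withinW.
have Wtot s t : W s t || W t s by exact: (wo_chainW Wchain).
have Wanti s t : W s t -> W t s -> s = t.
  by move=> st ts; apply: (wo_chain_antisymmetric Wchain) => //; rewrite st.
exists (fun s t => (mx s < mx t) || ((mx s == mx t) && W s t)).
have anti : antisymmetric (fun s t => (mx s < mx t) || ((mx s == mx t) && W s t)).
  move=> s t; case: (ltgtP (mx s) (mx t)) => //= _ /andP[]; exact: Wanti.
split=> //.
- apply: antisymmetric_well_order => // A [a Aa].
  have [|_ [s As <-] smin] := @least (fun x => exists2 t, t \in A & mx t = x).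
    by exists (mx a), a.
  have [|t [At st] tmin] :=
      well_order_least (P := fun t => t \in A /\ mx s = mx t) Wwo.
    by exists s.
  exists t; split=> // u Au; rewrite -st.
  have : mx s <= mx u by apply: smin; exists u.
  by rewrite le_eqVlt => /orP[/eqP su|->//]; rewrite su eqxx tmin ?orbT.
- by move=> s t; case: (ltgtP (mx s) (mx t)) => //= _; exact: Wtot.
- move=> t g; have [b bP] := bounded_tuples (mx t) g.
  exists b => s st; apply: bP => x /(le_foldr_max x0) xs; apply: le_trans xs _.
  by case: (ltgtP (mx s) (mx t)) st.
Qed.

Lemma weakly_compact_ramsey (n : nat) (A : set K) (f : n.-tuple K -> nat) :
  unbounded A ->
  exists H : set K, [/\ unbounded H, H `<=` A &
    exists l, forall t : n.-tuple K, sorted <%O t ->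
      (forall x, x \in t -> H x) -> f t = l].
Proof.
elim: n A f => [|n IHn] A f Aunb.
  by exists A; split=> //; exists (f [tuple]) => t _ _; rewrite tuple0.
have [R [Rwo Rtot Ranti Rbd]] := tuple_well_order n.
have [B [Bunb BA fB]] := eventually_constant_subfamily
  (fun a t => f (rcons_tuple t a)) Rwo Rtot Ranti Rbd Aunb.
(* [v t] is the eventual value of [f (t, _)], reached past [g t]; [G m] bounds [g] over all tuples
   with entries up to [m]. *)
have /choice[g {fB}/choice[v gvP]] := fB.
have /choice[G GP] m := bounded_tuples m g.
(* On [C], each element lies beyond the point where [f (t, _)] has stabilised
   for all tuples [t] of smaller elements: [f] is end-homogeneous there. *)
have [C [Cunb CB [l Cl]]] := unbounded_pairs (fun a b => G a < b) Bunb.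
(* The homogeneous colour is true, since the unbounded [C] has an element above both [a] and
   [G a]. *)
have {}Cl a b : C a -> C b -> a < b -> G a < b.
  move=> Ca Cb ab; rewrite Cl //.
  have [c Cc] := Cunb (Order.max a (G a)); rewrite gt_max => /andP[ac Gc].
  by rewrite -(Cl a c) // Gc.
have [H [Hunb HC [k Hk]]] := IHn C v Cunb.
have [x0] := weakly_compact_inhabited.
have [a0 Ha0 _] := Hunb x0.
(* Keeping only elements above [a0] makes [last a0 s] an element of [H] below [a] even when [s] is
   empty. *)
exists (H `&` [set y | a0 < y]); split.
- move=> x; have [y Hy] := Hunb (Order.max x a0).
  by rewrite gt_max => /andP[xy a0y]; exists y.
- by move=> x [/HC/CB/BA].
exists k => t.
have [s [a ->]] : exists (s : n.-tuple K) a, t = rcons_tuple s a.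
  case: t => t; case/lastP: t => [//|s a] tn.
  have sn : size s == n by move: tn; rewrite size_rcons eqSS.
  by exists (Tuple sn), a; apply: val_inj.
move=> sa_sorted saH.
have sH x : x \in s -> H x /\ a0 < x.
  by move=> xs; apply: saH; rewrite mem_rcons inE xs orbT.
have [Ha a0a] : H a /\ a0 < a by apply: saH; rewrite mem_rcons mem_head.
have /andP[a0s sa] : path <%O a0 s && (last a0 s < a).
  rewrite -rcons_path (path_sortedE lt_trans) sa_sorted andbT.
  by apply/allP => x xsa; have [] := saH x xsa.
have Hlast : H (last a0 s).
  by have := mem_last a0 s; rewrite inE => /orP[/eqP ->|/sH[]].
rewrite -(Hk s (path_sorted a0s) (fun x xs => (sH x xs).1)).
apply: gvP; first exact/CB/HC.
apply: lt_trans (Cl _ _ (HC _ Hlast) (HC _ Ha) sa).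
by apply: GP => x xs; apply: path_lt_le_last => //; rewrite inE xs orbT.
Qed.

End WeaklyCompact.

(** * The cofinal function built from a homogeneous set *)

Theorem theorem8p14 (d : Order.disp_t) (K : orderType d)
  (hK : weakly_compact K) (n : nat) : PH n K.
Proof.
move=> c.
have Tunb : unbounded [set: K].
  by move=> x; have [y xy] := weakly_compact_no_max hK x; exists y.
have [H [Hunb _ [l Hl]]] := weakly_compact_ramsey hK c Tunb.
have [x0] := weakly_compact_inhabited hK.
have [nu nuP numono] := unbounded_next hK Hunb.
have itermono k x y : x <= y -> iter k nu x <= iter k nu y.
  by move=> xy; elim: k => //= k; exact: numono.
have iterlt x : {homo (fun k => iter k nu x) : j k / (j < k)%N >-> j < k}.
  by apply: (homo_ltn lt_trans) => k /=; have [] := nuP (iter k nu x).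
pose F (s : nonempty_upto K n.+1) :=
  iter (size (val s)) nu (foldr Order.max x0 (val s)).
(* A longer sequence gets more applications of [nu], so [F] is strictly increasing along proper
   extensions, as increasing tuples require. *)
have Flt (s t : nonempty_upto K n.+1) : subseq (val s) (val t) ->
    (size (val s) < size (val t))%N -> F s < F t.
  move=> st sz; apply: le_lt_trans (iterlt _ _ _ sz).
  exact/itermono/foldr_max_subseq.
exists F; first split.
- move=> s x sx; rewrite /F sx /=; have [_ lt_nu] := nuP (Order.max x x0).
  by apply: le_trans (ltW lt_nu); rewrite le_max lexx.
(* A subsequence that is not shorter is the whole sequence. *)
- move=> s t st; have [/(Flt _ _ st)/ltW //|sz] := ltnP (size (val s)) (size (val t)).
  suff -> : s = t by [].
  apply: val_inj; apply/eqP.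
  by rewrite -(size_subseq_leqif st) eqn_leq size_subseq.
exists l => sigma [szs subs]; apply: Hl.
- apply/(sortedP x0) => i; rewrite size_tuple => i_lt.
  have i_lt' := ltnW i_lt.
  rewrite -[i]/(val (Ordinal i_lt')) -[(val _).+1]/(val (Ordinal i_lt)).
  rewrite -!tnth_nth !tnth_mktuple; apply: Flt; first exact: subs.
  by rewrite !szs.
(* Position [i] carries [i.+1] applications of [nu]; the outermost one lands in [H]. *)
- move=> x /tnthP[i ->]; rewrite tnth_mktuple /F szs /=.
  by have [] := nuP (iter i nu (foldr Order.max x0 (val (tnth sigma i)))).
Qed.
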